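(* Let $q$ be a power of a prime $p$ and let $K$ be an algebraic closure of $\mathbb{F}_q$. Let $\mathrm{AGL}(2,q)$ denote the stabilizer in $\mathrm{PGL}(3,q)$ of the line $Z=0$, acting on $\mathrm{PG}(2,K)$. Then $d(\mathrm{AGL}(2,q))=q^3-q^2$; that is, every $\mathrm{AGL}(2,q)$-invariant irreducible plane curve over $K$ other than a line has degree at least $q^3-q^2$, and there exists an $\mathrm{AGL}(2,q)$-invariant irreducible plane curve of degree $q^3-q^2$.
   Context: A plane curve is a projective plane curve $F(X,Y,Z)=0$ over $K$; it is irreducible if $F$ is irreducible over $K$. For a subgroup $G\le \mathrm{PGL}(3,K)$, a curve is $G$-invariant if every element of $G$ maps it onto itself. $d(G)$ denotes the smallest degree of a $G$-invariant irreducible plane curve other than a line. *)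

(* Defs.v *)
From HB Require Import structures.
From mathcomp Require Import all_boot all_order all_algebra.
From mathcomp Require Import mpoly.
Set Implicit Arguments. Unset Strict Implicit. Unset Printing Implicit Defensive.
Import GRing.Theory.
Local Open Scope ring_scope.

Definition algebraic_over_prime_field (K : fieldType) : Prop :=
  forall x : K, exists P : {poly K},
    P != 0 /\ (forall i : nat, exists m : nat, P`_i = m%:R) /\ root P x.

Definition in_Fq (K : fieldType) (q : nat) (x : K) : bool := x ^+ q == x.

(* Matrix representatives (acting on column vectors (X,Y,Z)^T) of the
   elements of PGL(3,q) stabilizing the line Z = 0, i.e. AGL(2,q). *)
Definition AGL2_mx (K : fieldType) (q : nat) (M : 'M[K]_3) : Prop :=
  (forall i j, in_Fq q (M i j)) /\ M \in unitmx /\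
  M ord_max ord0 = 0 /\ M ord_max (lift ord0 ord0) = 0.

Definition mx_act (K : fieldType) (M : 'M[K]_3) (F : {mpoly K[3]}) : {mpoly K[3]} :=
  F \mPo [tuple (\sum_(j < 3) M i j *: 'X_j) | i < 3].

(* The curve F = 0 is mapped onto itself by M (F defined up to a scalar) *)
Definition mx_invariant (K : fieldType) (M : 'M[K]_3) (F : {mpoly K[3]}) : Prop :=
  exists c : K, c != 0 /\ mx_act M F = c *: F.

Definition AGL2_invariant (K : fieldType) (q : nat) (F : {mpoly K[3]}) : Prop :=
  forall M : 'M[K]_3, AGL2_mx q M -> mx_invariant M F.

(* Irreducibility over K: nonconstant, and any factorization has a nonzero
   constant factor (msize = 1 iff nonzero constant). *)
Definition mirreducible (K : fieldType) (F : {mpoly K[3]}) : Prop :=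
  (1 < msize F)%N /\
  forall G H : {mpoly K[3]}, F = G * H -> msize G = 1%N \/ msize H = 1%N.

Definition irred_plane_curve (K : fieldType) (F : {mpoly K[3]}) (d : nat) : Prop :=
  F != 0 /\ F \is d.-homog /\ mirreducible F.

(* Main.v *)
(** Lower bound. Let [F] be an invariant curve of degree [d < q^3 - q^2], not a
    line. Since [F] is not divisible by [X], the diagonal elements [X -> aX] fix
    [F]. Invariance under [X -> X + aZ] makes [F(X,1,Z)] a polynomial in
    [X^q - Z^(q-1) X], so [F(X,1,0)] is a polynomial in [X^q]; invariance under
    [X -> X + aY] makes it a polynomial [g] in [X^(q^2) - X^q]. Then
    [deg g < q - 1] and [g(aX) = g(X)] for [a] in [F_q^*], so [g] is constant.
    Hence [F(X,Y,0)] is a multiple of [Y^d], by symmetry also of [X^d], and so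
    it vanishes: [Z] divides [F].

    Existence. Put [U = X^q - Z^(q-1) X], [V = Y^q - Z^(q-1) Y] and take
    [F = prod_t (U - t V) + Z^(q^3 - q^2)],  [t] in [F_(q^2) \ F_q].
    The product is the Dickson invariant [(U^(q^2) V - V^(q^2) U) / (U^q V - V^q U)],
    where numerator and denominator are both multiplied by the determinant.
    For irreducibility, let [F = A B]. The points at infinity are [(t^q : 1 : 0)];
    the Newton polygon at such a point has a single edge, of slope [q/(q-1)], so
    [A] and [B] do not both vanish there. Thus [A] and [B] have coprime
    restrictions to [Z = 0]. Modulo [Z^(q^3 - q^2)] they agree, by uniqueness in
    Hensel's lemma, with partial products of [prod_t (U - t V)], and the degrees
    turn this into an equality; but [F] is not equal to the product. *)

Require Import Defs.
From HB Require Import structures.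
From mathcomp Require Import all_boot all_order all_algebra.
From mathcomp Require Import mpoly.
From mathcomp Require Import separable.
From mathcomp Require Import ring zify.
Set Implicit Arguments. Unset Strict Implicit. Unset Printing Implicit Defensive.
Import GRing.Theory.
Local Open Scope ring_scope.

(** * Frobenius powers and the roots of [X^n - v^(n-1) X] *)

Lemma mpoly_rmorph_ext (n : nat) (R : nzRingType) (S : pzRingType)
    (f g : {rmorphism {mpoly R[n]} -> S}) :
  (forall c, f c%:MP = g c%:MP) -> (forall i, f 'X_i = g 'X_i) -> f =1 g.
Proof.
move=> eqC eqX F; rewrite [F]mpolyE !rmorph_sum /=; apply: eq_bigr => m _.
rewrite -mul_mpolyC !rmorphM /= eqC; congr (_ * _).
by rewrite mpolyXE_id !rmorph_prod; apply: eq_bigr => i _; rewrite !rmorphXn /= eqX.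
Qed.

Section FrobeniusPower.

Variables (p k : nat).
Hypotheses (k_gt0 : (0 < k)%N).
Let q := (p ^ k)%N.

Lemma pchar_expn_nat (R : nzSemiRingType) : p \in [pchar R] -> [pchar R].-nat q.
Proof.
move=> pR; have p_pr := pcharf_prime pR.
by rewrite /q pnatX pnatE // pR.
Qed.

Lemma pchar_expn_gt1 (R : nzSemiRingType) : p \in [pchar R] -> (1 < q)%N.
Proof. by move=> pR; rewrite -(exp1n k) ltn_exp2r ?prime_gt1 ?(pcharf_prime pR). Qed.

Lemma pchar_natr_eq0 (R : nzSemiRingType) : p \in [pchar R] -> q%:R = 0 :> R.
Proof. by move=> pR; rewrite natrX (pcharf0 pR) expr0n gtn_eqF. Qed.

Lemma expq_D (R : comNzRingType) (x y : R) :
  p \in [pchar R] -> (x + y) ^+ q = x ^+ q + y ^+ q.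
Proof. by move=> /pchar_expn_nat; apply: exprDn_pchar. Qed.

Lemma expq_B (R : comNzRingType) (x y : R) :
  p \in [pchar R] -> (x - y) ^+ q = x ^+ q - y ^+ q.
Proof.
by move=> pR; apply/eqP; rewrite eq_sym subr_eq -expq_D // subrK.
Qed.

End FrobeniusPower.

Lemma size_XnBX (R : nzRingType) (n : nat) (c : R) :
  (1 < n)%N -> size ('X^n - c *: 'X : {poly R}) = n.+1.
Proof.
move=> n_gt1; rewrite size_polyDl size_polyXn // size_polyN.
by apply: leq_ltn_trans (size_scale_leq _ _) _; rewrite size_polyX.
Qed.

Lemma lead_coef_XnBX (R : nzRingType) (n : nat) (c : R) :
  (1 < n)%N -> lead_coef ('X^n - c *: 'X) = 1.
Proof.
move=> n_gt1; rewrite lead_coefDl ?lead_coefXn // size_polyN size_polyXn.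
by apply: leq_ltn_trans (size_scale_leq _ _) _; rewrite size_polyX.
Qed.

(** The derivative of [X^n - X] is [-1] since [n] vanishes in [K], so the roots are simple. With
    [n = q] and [n = q^2] this enumerates [F_q] and [F_(q^2)]. *)
Lemma fixed_points_expn (K : closedFieldType) (n : nat) :
  (1 < n)%N -> n%:R = 0 :> K ->
  exists s : seq K, [/\ uniq s, size s = n & forall x, (x \in s) = (x ^+ n == x)].
Proof.
move=> n_gt1 n0.
have [s] := closed_field_poly_normal ('X^n - 1 *: 'X : {poly K}).
rewrite lead_coef_XnBX // [RHS]scale1r => Ps.
exists s; split.
- rewrite -separable_prod_XsubC -Ps unlock scale1r derivB derivX derivXn.
  by rewrite -mulr_natl -polyC_natr n0 mul0r sub0r -[X in coprimep _ X]scaleN1r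
          coprimepZr ?oppr_eq0 ?oner_eq0 // coprimep1.
- by apply/eqP; rewrite -eqSS -(size_prod_XsubC s id) -Ps size_XnBX.
- by move=> x; rewrite -root_prod_XsubC -Ps rootE !hornerE subr_eq0.
Qed.

(** For [v != 0] the elements [f a * v] are [n] distinct roots of the monic [X^n - v^(n-1) X], which
    is then evaluated at [u]. For [v = 0] they collapse, hence the separate case. *)
Lemma prod_fixed_points_field (K E : fieldType)
    (f : {rmorphism K -> E}) (n : nat) (s : seq K) (u v : E) :
  (1 < n)%N -> uniq s -> size s = n -> (forall x, (x \in s) = (x ^+ n == x)) ->
  \prod_(a <- s) (u - f a * v) = u ^+ n - v ^+ n.-1 * u.
Proof.
case: n => // n n_gt0 us ss sP /=.
have [->|v0] := eqVneq v 0.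
  rewrite expr0n gtn_eqF //= mul0r subr0.
  under eq_bigr do rewrite mulr0 subr0.
  by rewrite big_const_seq count_predT ss iter_mulr_1.
pose P : {poly E} := 'X^(n.+1) - (v ^+ n) *: 'X.
have sizeP : size P = (size [seq f a * v | a <- s]).+1.
  by rewrite size_map ss size_XnBX.
have rootP : all (root P) [seq f a * v | a <- s].
  apply/allP => _ /mapP[a as_ ->]; rewrite rootE hornerD hornerN hornerZ hornerXn hornerX.
  move: as_; rewrite sP => /eqP aE.
  rewrite exprMn -rmorphXn aE exprS; apply/eqP; ring.
have uniqP : uniq_roots [seq f a * v | a <- s].
  by rewrite uniq_rootsE map_inj_uniq // => x y /(mulIf v0)/fmorph_inj.
have := congr1 (horner^~ u) (all_roots_prod_XsubC sizeP rootP uniqP).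
rewrite /P lead_coef_XnBX // [X in _ = X.[_]]scale1r !hornerE => ->.
by rewrite big_map horner_prod; apply: eq_bigr => a _; rewrite !hornerE.
Qed.

Lemma prod_fixed_points (K : fieldType) (R : idomainType)
    (f : {rmorphism K -> R}) (n : nat) (s : seq K) (u v : R) :
  (1 < n)%N -> uniq s -> size s = n -> (forall x, (x \in s) = (x ^+ n == x)) ->
  \prod_(a <- s) (u - f a * v) = u ^+ n - v ^+ n.-1 * u.
Proof.
move=> n_gt1 us ss sP; apply/eqP; rewrite -tofrac_eq; apply/eqP.
rewrite rmorph_prod !(rmorphB, rmorphM, rmorphXn) /=.
rewrite -(prod_fixed_points_field (@tofrac R \o f) _ _ n_gt1 us ss sP).
by apply: eq_bigr => a _; rewrite !(rmorphB, rmorphM).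
Qed.

Lemma mpoly_factor_X (n : nat) (K : fieldType) (F : {mpoly K[n]}) (i : 'I_n) :
  (forall m : 'X_{1..n}, m i = 0%N -> F@_m = 0) -> exists G, F = 'X_i * G.
Proof.
move=> F0; exists (\sum_(m <- msupp F) F@_m *: 'X_[m - U_(i)]).
rewrite {1}[F]mpolyE mulr_sumr; apply: eq_big_seq => m mF.
rewrite -scalerAr -mpolyXD addmC submK // lep1mP.
by apply: contraL mF => /eqP mi; rewrite mcoeff_msupp F0 // eqxx.
Qed.

(** * Translation-invariant polynomials *)

(** If [S] is nonempty, [r - r.[x]] has at least [size S] roots and degree below [size S]; if [S] is
    empty, [r] is zero. *)
Lemma small_invariant_poly_const (R : idomainType) (r : {poly R}) (x : R) (S : seq R) :
  uniq S -> (size r <= size S)%N -> (forall a, a \in S -> r.[a] = r.[x]) ->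
  r = (r.[x])%:P.
Proof.
move=> uS sr rS; apply/eqP; rewrite -subr_eq0; apply: contraT => r0.
have [S0|S_gt0] := posnP (size S).
  by move: sr r0; rewrite S0 leqn0 size_poly_eq0 => /eqP->; rewrite horner0 subrr eqxx.
have /(max_poly_roots r0)/(_ uS) : all (root (r - r.[x]%:P)) S.
  by apply/allP => a /rS ra; rewrite rootE !hornerE ra subrr.
rewrite ltnNge (leq_trans (size_polyD _ _)) // geq_max sr size_polyN.
by rewrite (leq_trans (size_polyC_leq1 _)).
Qed.

(** The polynomial [m = X^q - z^(q-1) X] is itself invariant, because [(az)^q = z^(q-1) (az)].
    Uniqueness of division by [m] makes the quotient and the remainder of [f] invariant. The
    remainder has degree below [q] and takes one value at the [q] points [az], so it is constant;
    induction applies to the quotient. *)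
Lemma translation_invariant_poly (R : idomainType) (p k : nat) (S : seq R) (z : R)
    (f : {poly R}) :
  let q := (p ^ k)%N in
  p \in [pchar R] -> (0 < k)%N -> z != 0 -> uniq S -> size S = q ->
  {in S, forall a, a ^+ q = a} ->
  {in S, forall a, f \Po ('X + (a * z)%:P) = f} ->
  exists h, f = h \Po ('X^q - z ^+ q.-1 *: 'X).
Proof.
move=> q pR k0 z0 uS sS Sq.
have q_gt1 : (1 < q)%N by apply: pchar_expn_gt1 pR.
set m := 'X^q - _; have sm : size m = q.+1 by rewrite size_XnBX.
have m_monic : m \is monic by rewrite monicE lead_coef_XnBX.
have m0 : m != 0 by rewrite monic_neq0.
have mS a : a \in S -> m \Po ('X + (a * z)%:P) = m.
  move=> /Sq aq; rewrite comp_polyB comp_Xn_poly comp_polyZ comp_polyX.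
  rewrite expq_D ?(rmorph_pchar polyC) // -rmorphXn exprMn aq scalerDr scale_polyC.
  have -> : z ^+ q.-1 * (a * z) = a * z ^+ q.
    by rewrite mulrCA -exprSr prednK // ltnW.
  by rewrite /m; ring.
have [n] := ubnP (size f); elim: n f => // n IHn f; rewrite ltnS => sf fS.
have [g [r [fE sr]]] : exists g r, f = g * m + r /\ (size r < size m)%N.
  exists (Pdiv.Ring.rdivp f m), (Pdiv.Ring.rmodp f m).
  by rewrite -Pdiv.RingMonic.rdivp_eq // Pdiv.Ring.ltn_rmodpN0.
have sXa a : size ('X + (a * z)%:P) = 2%N by rewrite size_XaddC.
have gS a : a \in S -> g \Po ('X + (a * z)%:P) = g.
  move=> aS; have := fS a aS; rewrite {1}fE comp_polyD comp_polyM mS // => fE2.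
  have gE : ((g \Po ('X + (a * z)%:P)) - g) * m = r - (r \Po ('X + (a * z)%:P)).
    by apply/eqP; rewrite mulrBl subr_eq addrAC eq_sym subr_eq eq_sym fE2 [r + _]addrC -fE.
  (* A nonzero multiple of the monic [m] cannot be smaller than [m]. *)
  apply/eqP; rewrite -subr_eq0; apply: contraT => g0.
  have := leq_ltn_trans (size_polyD r (- (r \Po ('X + (a * z)%:P)))) (_ : _ < size m)%N.
  rewrite gtn_max sr size_polyN size_comp_poly2 // sr => /(_ isT).
  by rewrite -gE size_Mmonic // sm addnS /= ltnS
    -[X in (_ <= X)%N]add0n leq_add2r leqn0 size_poly_eq0 (negPf g0).
have rS a : a \in S -> r \Po ('X + (a * z)%:P) = r.
  move=> aS; have := fS a aS; rewrite {2}fE {1}fE comp_polyD comp_polyM mS // gS //.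
  by move/addrI.
have rC : r = (r.[0])%:P.
  apply: (@small_invariant_poly_const _ _ _ [seq a * z | a <- S]).
  - by rewrite map_inj_uniq //; apply: mulIf.
  - by rewrite size_map sS -ltnS -sm.
  - move=> _ /mapP[a aS ->]; rewrite -{2}(rS a aS) horner_comp.
    by rewrite !hornerE.
have [f0|f0] := eqVneq f 0; first by exists 0; rewrite comp_poly0.
have [|h gE] := IHn g _ gS; last first.
  by exists (h * 'X + r.[0]%:P); rewrite comp_poly_MXaddC -gE -rC.
have [->|g0] := eqVneq g 0; first by rewrite size_poly0 (leq_trans _ sf) ?size_poly_gt0.
apply: leq_trans sf; rewrite fE size_polyDl size_Mmonic // sm addnS /=.
  by rewrite -[X in (X < _)%N]addn0 ltn_add2l ltnW.
rewrite (leq_trans sr) // sm -addn1 addnC leq_add2r.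
by rewrite lt0n size_poly_eq0.
Qed.

(** * Specializations of ternary polynomials *)

Local Notation i0 := (@ord0 2).
Local Notation i1 := (lift ord0 (@ord0 1)).
Local Notation i2 := (@ord_max 2).

Lemma ord3P (P : 'I_3 -> Prop) : P i0 -> P i1 -> P i2 -> forall i, P i.
Proof.
move=> P0 P1 P2 [[|[|[|i]]] ilt] //.
- by rewrite (_ : Ordinal ilt = i0) //; apply: val_inj.
- by rewrite (_ : Ordinal ilt = i1) //; apply: val_inj.
- by rewrite (_ : Ordinal ilt = i2) //; apply: val_inj.
Qed.

Lemma big_ord3 (R : Type) (idx : R) (op : Monoid.law idx) (F : 'I_3 -> R) :
  \big[op/idx]_(i < 3) F i = op (F i0) (op (F i1) (F i2)).
Proof.
rewrite !big_ord_recl big_ord0 Monoid.mulm1; congr (op _ (op _ (F _))).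
exact: val_inj.
Qed.

Section Eval3.

Variables (K : fieldType) (S : comNzRingType) (f : {rmorphism K -> S}).
Implicit Types (x y z : S) (F : {mpoly K[3]}).

(** The target ring is arbitrary so that the restriction to infinity, the affine chart and the
    substitution at a point at infinity are all instances, compared through [map_ev3]. *)
Definition ev3 x y z : {mpoly K[3]} -> S :=
  mmap f (fun i : 'I_3 => [:: x; y; z]`_i).

HB.instance Definition _ x y z := GRing.RMorphism.copy (ev3 x y z)
  (mmap f (fun i : 'I_3 => [:: x; y; z]`_i)).

Lemma ev3C x y z c : ev3 x y z c%:MP = f c.
Proof. exact: mmapC. Qed.

Lemma ev3Z x y z c F : ev3 x y z (c *: F) = f c * ev3 x y z F.
Proof. exact: mmapZ. Qed.

Lemma ev3X x y z :
  (ev3 x y z 'X_i0 = x) * (ev3 x y z 'X_i1 = y) * (ev3 x y z 'X_i2 = z).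
Proof. by rewrite /ev3 !mmapX !mmap1U. Qed.

Lemma ev3Xm x y z m :
  ev3 x y z 'X_[m] = x ^+ m i0 * (y ^+ m i1 * z ^+ m i2).
Proof. by rewrite /ev3 mmapX /mmap1 big_ord3. Qed.

Lemma ev3E x y z F :
  ev3 x y z F = \sum_(m <- msupp F) f F@_m * (x ^+ m i0 * (y ^+ m i1 * z ^+ m i2)).
Proof.
by rewrite {1}[F]mpolyE rmorph_sum; apply: eq_bigr => m _ /=; rewrite ev3Z ev3Xm.
Qed.

Lemma ev3_unique (g : {rmorphism {mpoly K[3]} -> S}) F :
  (forall c, g c%:MP = f c) -> g F = ev3 (g 'X_i0) (g 'X_i1) (g 'X_i2) F.
Proof.
move=> gC; apply: (mpoly_rmorph_ext (f := g) (g := ev3 _ _ _)) => [c|i] /=; first by rewrite gC ev3C.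
by move: i; apply: ord3P; rewrite ev3X.
Qed.

Lemma ev3_act x y z (M : 'M[K]_3) F :
  ev3 x y z (mx_act M F) =
  ev3 (f (M i0 i0) * x + (f (M i0 i1) * y + f (M i0 i2) * z))
      (f (M i1 i0) * x + (f (M i1 i1) * y + f (M i1 i2) * z))
      (f (M i2 i0) * x + (f (M i2 i1) * y + f (M i2 i2) * z)) F.
Proof.
pose t := [tuple (\sum_(j < 3) M i j *: 'X_j) | i < 3] : 3.-tuple {mpoly K[3]}.
have tE i : ev3 x y z (comp_mpoly t 'X_i)
          = f (M i i0) * x + (f (M i i1) * y + f (M i i2) * z).
  rewrite comp_mpolyXU -tnth_nth tnth_mktuple big_ord3.
  by rewrite !rmorphD /= !ev3Z !ev3X.
rewrite -!tE; apply: (ev3_unique (g := ev3 x y z \o comp_mpoly t)) => c.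
by rewrite /= comp_mpolyC ev3C.
Qed.

End Eval3.

Lemma map_ev3 (K : fieldType) (S T : comNzRingType) (f : {rmorphism K -> S})
    (h : {rmorphism K -> T}) (g : {rmorphism S -> T}) (x y z : S) (F : {mpoly K[3]}) :
  (forall c, g (f c) = h c) -> g (ev3 f x y z F) = ev3 h (g x) (g y) (g z) F.
Proof.
move=> gf; have := @ev3_unique K T h (g \o ev3 f x y z) F.
by rewrite /= !ev3X; apply=> c; rewrite ev3C.
Qed.

Lemma ev3_mpolyX (K : fieldType) (F : {mpoly K[3]}) :
  ev3 (@mpolyC 3 K) 'X_i0 'X_i1 'X_i2 F = F.
Proof. by rewrite -(ev3_unique (g := idfun)). Qed.

Definition affine_mx (K : fieldType) (a b c a' b' c' e : K) : 'M[K]_3 :=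
  \matrix_(i, j) (nth [::] [:: [:: a; b; c]; [:: a'; b'; c']; [:: 0; 0; e]] i)`_j.

Lemma det3_affine (K : fieldType) (M : 'M[K]_3) :
  M i2 i0 = 0 -> M i2 i1 = 0 ->
  \det M = M i2 i2 * (M i0 i0 * M i1 i1 - M i0 i1 * M i1 i0).
Proof.
move=> M20 M21; rewrite (expand_det_row _ i2) big_ord3 /= M20 M21 !mul0r !add0r.
congr (_ * _); rewrite /cofactor -signr_odd expr0 mul1r.
rewrite (expand_det_row _ ord0) !big_ord_recl big_ord0 addr0.
rewrite /cofactor !det_mx11 !mxE /= expr0 mul1r.
rewrite /bump /= expr1 mulN1r mulrN.
congr (M _ _ * M _ _ - M _ _ * M _ _); exact: val_inj.
Qed.

(** * The lower bound *)

Lemma affine_mx_AGL2 (K : fieldType) (q : nat) (a b c a' b' c' e : K) :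
  (0 < q)%N -> all (in_Fq q) [:: a; b; c; a'; b'; c'; e] ->
  e * (a * b' - b * a') != 0 -> AGL2_mx q (affine_mx a b c a' b' c' e).
Proof.
move=> q_gt0 /and5P[aq bq cq a'q /and4P[b'q c'q eq _]] D0; split.
  have z : in_Fq q (0 : K) by rewrite /in_Fq expr0n gtn_eqF.
  by apply: ord3P; apply: ord3P; rewrite mxE.
split; last by rewrite !mxE.
by rewrite unitmxE unitfE det3_affine !mxE.
Qed.

(** The scalar [s] is chosen before the ring and the point, so it can be determined by one
    evaluation and used in another. *)
Lemma AGL2_invariant_ev3 (K : fieldType) (q : nat) (F : {mpoly K[3]})
    (a b c a' b' c' : K) :
  AGL2_invariant q F -> (0 < q)%N -> all (in_Fq q) [:: a; b; c; a'; b'; c'] ->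
  a * b' - b * a' != 0 ->
  exists2 s : K, s != 0 &
  forall (S : comNzRingType) (f : {rmorphism K -> S}) (x y z : S),
    ev3 f (f a * x + (f b * y + f c * z)) (f a' * x + (f b' * y + f c' * z)) z F
    = f s * ev3 f x y z F.
Proof.
move=> Finv q_gt0 abcq D0.
have /Finv[s [s0 Fs]] : AGL2_mx q (affine_mx a b c a' b' c' 1).
  apply: affine_mx_AGL2 => //; last by rewrite mul1r.
  move: abcq; rewrite /= => /and5P[-> -> -> -> /and3P[-> -> _]] /=.
  by rewrite /in_Fq expr1n eqxx.
exists s => // S f x y z; rewrite -ev3Z -Fs ev3_act !mxE /=.
by rewrite rmorph0 rmorph1 !mul0r !add0r mul1r.
Qed.

(** Substituting a monic linear polynomial preserves the leading coefficient, which forces [c = 1]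
    when [f] is nonzero. *)
Lemma comp_poly_scale_eq (R : idomainType) (f g : {poly R}) (c : R) :
  size g = 2%N -> lead_coef g = 1 -> f \Po g = c *: f -> f \Po g = f.
Proof.
move=> sg lg fg; have [->|f0] := eqVneq f 0; first by rewrite comp_poly0.
have := congr1 lead_coef fg; rewrite lead_coef_comp ?sg // lg expr1n mulr1 lead_coefZ.
rewrite -[LHS]mul1r => /mulIf c1.
by rewrite fg -c1 ?scale1r // lead_coef_eq0.
Qed.

(** On [Z = 0] a monomial of degree [d] is determined by either of its other exponents, so no terms
    merge. The boolean selects the chart [Y = 1] or [X = 1]. *)
Lemma coef_line_at_infinity (K : fieldType) (F : {mpoly K[3]}) (d : nat) (b : bool)
    (m : 'X_{1..3}) :
  F \is d.-homog -> m i2 = 0%N -> mdeg m = d ->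
  (ev3 polyC (if b then 'X else 1) (if b then 1 else 'X) 0 F)`_(if b then m i0 else m i1)
  = F@_m.
Proof.
move=> Fd m2 md; rewrite ev3E coef_sum [in RHS](mpolyE F) raddf_sum /=.
apply: eq_big_seq => m' m'F; rewrite mcoeffZ mcoeffX coefCM; congr (_ * _).
have m'd : mdeg m' = d by move/dhomogP: Fd; apply.
rewrite !mdegE !big_ord3 /= in md m'd.
have [m'2|m'2] := eqVneq (m' i2) 0%N; last first.
  rewrite (expr0n _ (m' i2)) (negPf m'2) !mulr0 coef0.
  by rewrite (_ : (m' == m) = false) //; apply: contra_neqF m'2 => /eqP->.
rewrite m'2 expr0 mulr1.
have -> : (if b then 'X else 1) ^+ m' i0 * (if b then 1 else 'X) ^+ m' i1
    = 'X^(if b then m' i0 else m' i1) :> {poly K}.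
  by case: (b); rewrite expr1n ?mulr1 ?mul1r.
rewrite coefXn; congr ((nat_of_bool _)%:R); rewrite eq_sym.
apply/eqP/eqP => [e|-> //]; apply/mnmP; apply: ord3P.
all: by case: (b) e => e; lia.
Qed.

Lemma size_line_at_infinity (K : fieldType) (F : {mpoly K[3]}) (d : nat) :
  F \is d.-homog -> (size (ev3 polyC 'X 1 0 F) <= d.+1)%N.
Proof.
move=> Fd; rewrite ev3E; apply: (leq_trans (size_sum _ _ _)).
apply/bigmax_leqP_seq => m mF _.
have md : mdeg m = d by move/dhomogP: Fd; apply.
rewrite mdegE big_ord3 /= in md; rewrite mul_polyC expr1n mul1r.
apply: (leq_trans (size_scale_leq _ _)); rewrite expr0n.
case: eqP => _; last by rewrite mulr0 size_poly0.
by rewrite mulr1 size_polyXn; lia.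
Qed.

Lemma mcoeff_ev3_scale (K : fieldType) (F : {mpoly K[3]}) (a : K) (m : 'X_{1..3}) :
  (ev3 (@mpolyC 3 K) (a *: 'X_i0) 'X_i1 'X_i2 F)@_m = F@_m * a ^+ m i0.
Proof.
rewrite [in LHS](mpolyE F) rmorph_sum [in RHS](mpolyE F) !raddf_sum /= mulr_suml.
apply: eq_bigr => m' _; rewrite ev3Z ev3Xm exprZn -scalerAl mul_mpolyC !mcoeffZ.
rewrite (_ : _ * (_ * _) = 'X_[m']); last first.
  by rewrite [RHS]mpolyXE_id big_ord3.
rewrite mcoeffX; have [->|_] := eqVneq m' m; first by rewrite !mulr1.
by rewrite !mulr0 mul0r.
Qed.

Section LowerBound.

Variables (K : closedFieldType) (p k : nat).
Hypotheses (k_gt0 : (0 < k)%N) (pK : p \in [pchar K]).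
Let q := (p ^ k)%N.

Let q_gt1 : (1 < q)%N.
Proof. exact: pchar_expn_gt1 pK. Qed.

Let in_Fq0 : in_Fq q (0 : K).
Proof. by rewrite /in_Fq expr0n gtn_eqF // ltnW. Qed.

Let in_Fq1 : in_Fq q (1 : K).
Proof. by rewrite /in_Fq expr1n. Qed.

Lemma Fq_enum : exists s : seq K,
  [/\ uniq s, size s = q & forall x, (x \in s) = in_Fq q x].
Proof. by apply: fixed_points_expn => //; apply: pchar_natr_eq0. Qed.

Lemma AGL2_invariant_line_at_infinity (F : {mpoly K[3]}) :
  AGL2_invariant q F ->
  exists g : {poly K}, ev3 polyC 'X 1 0 F = g \Po ('X^q - 'X) \Po 'X^q.
Proof.
move=> Finv; have [s [us ss sP]] := Fq_enum.
have sq : {in s, forall a, a ^+ q = a} by move=> a; rewrite sP => /eqP.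
(* Here [X] is the outer variable and [Z] the inner one: the translations [X + aZ] must be exploited
   before [Z] is set to 0. *)
pose H : {poly {poly K}} := ev3 (polyC \o polyC) 'X 1 'X%:P F.
have HS : {in [seq a%:P | a <- s], forall a, H \Po ('X + (a * 'X)%:P) = H}.
  move=> _ /mapP[a as_ ->]; rewrite sP in as_.
  have [||c _ Fc] := @AGL2_invariant_ev3 K q F 1 0 a 0 1 0 Finv (ltnW q_gt1).
  - by rewrite /= in_Fq0 in_Fq1 as_.
  - by rewrite mulr1 mul0r subr0 oner_eq0.
  apply: (@comp_poly_scale_eq _ _ _ c%:P); rewrite ?size_XaddC ?lead_coefXaddC //.
  have /esym := Fc _ (polyC \o polyC) 'X 1 'X%:P.
  rewrite /= !polyC1 !polyC0 !mul0r !addr0 !mul1r !add0r => FcE.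
  rewrite -[RHS]mul_polyC FcE.
  rewrite /H (map_ev3 (h := polyC \o polyC)) /=; last by move=> b; rewrite comp_polyC.
  by rewrite comp_polyX !comp_polyC polyCM.
have [h HE] : exists h, H = h \Po ('X^q - 'X ^+ q.-1 *: 'X).
  apply: (translation_invariant_poly _ k_gt0 _ _ _ _ HS).
  - exact: (rmorph_pchar polyC).
  - by rewrite polyX_eq0.
  - by rewrite map_inj_uniq //; apply: polyC_inj.
  - by rewrite size_map.
  - by move=> _ /mapP[a as_ ->]; rewrite -rmorphXn /= sq.
(* [h0] is [h] at [Z = 0], where [X^q - Z^(q-1) X] becomes [X^q] because [q - 1 > 0]. *)
set F0 := ev3 polyC 'X 1 0 F; set h0 := map_poly (horner_eval 0) h.
have F0E : F0 = h0 \Po 'X^q.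
  have := congr1 (map_poly (horner_eval 0)) HE.
  rewrite map_comp_poly rmorphB /= map_polyXn map_polyZ map_polyX.
  rewrite [X in X *: _](_ : _ = 0) ?scale0r ?subr0 => [<-|]; last first.
    by rewrite /= /horner_eval hornerXn expr0n gtn_eqF // ltn_predRL.
  rewrite /F0 /H (map_ev3 (h := polyC)) /= ?rmorph1 ?map_polyX ?map_polyC /=.
    by rewrite /horner_eval hornerX.
  by move=> c; rewrite /= map_polyC /= /horner_eval hornerC.
(* Since [a^q = a], a translation by [a] passes through [X^q], so [h0] inherits the invariance of
   [F0]. *)
have XaE a : (a \in s) -> h0 \Po 'X^q \Po ('X + a%:P) = (h0 \Po ('X + a%:P)) \Po 'X^q.
  move=> as_; rewrite -!comp_polyA comp_Xn_poly expq_D ?(rmorph_pchar polyC) //.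
  by rewrite -rmorphXn /= sq // comp_polyD comp_polyC comp_polyX.
have F0S : {in s, forall a, F0 \Po ('X + a%:P) = F0}.
  move=> a as_; have aq : in_Fq q a by rewrite -sP.
  have [||c _ Fc] := @AGL2_invariant_ev3 K q F 1 a 0 0 1 0 Finv (ltnW q_gt1).
  - by rewrite /= in_Fq0 in_Fq1 aq.
  - by rewrite mulr1 mulr0 subr0 oner_eq0.
  apply: (@comp_poly_scale_eq _ _ _ c); rewrite ?size_XaddC ?lead_coefXaddC //.
  have := Fc _ polyC 'X 1 0.
  rewrite /= !polyC1 !polyC0 !mul0r !addr0 !mul1r !add0r mulr1 => FcE.
  rewrite -[RHS]mul_polyC -FcE /F0 (map_ev3 (h := polyC)) /= ?comp_polyX ?comp_polyC //.
  by move=> b; rewrite comp_polyC.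
have [g gE] : exists g, h0 = g \Po ('X^q - 1 ^+ q.-1 *: 'X).
  apply: (translation_invariant_poly pK k_gt0 (oner_neq0 _) us ss sq) => a as_.
  (* Composition with the nonconstant [X^q] is injective and can be cancelled. *)
  rewrite mulr1; apply/eqP; rewrite -subr_eq0 -(comp_poly_eq0 _ (q := 'X^q)).
    by rewrite comp_polyB -XaE // -F0E F0S // subrr.
  by rewrite size_polyXn ltnS ltnW.
by exists g; rewrite F0E gE expr1n scale1r.
Qed.

Lemma AGL2_invariant_line_at_infinity_const (F : {mpoly K[3]}) (d : nat) :
  AGL2_invariant q F -> F \is d.-homog -> (d < q ^ 3 - q ^ 2)%N ->
  (exists2 m : 'X_{1..3}, m i0 = 0%N & F@_m != 0) ->
  exists c, ev3 polyC 'X 1 0 F = c%:P.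
Proof.
move=> Finv Fd d_lt [m m0 Fm]; have [s [us ss sP]] := Fq_enum.
have [g gE] := AGL2_invariant_line_at_infinity Finv.
pose w : {poly K} := ('X^q - 'X) \Po 'X^q.
have size_w : (size w).-1 = (q * q)%N.
  have := size_XnBX (1 : K) q_gt1; rewrite scale1r => sXq.
  by rewrite size_comp_poly sXq size_polyXn.
(* The degree of [F(X,1,0)] is [q^2] times that of [g] and is below [q^2 (q - 1)]. *)
have g_small : ((size g).-1 < q.-1)%N.
  have := size_line_at_infinity Fd.
  rewrite gE -comp_polyA -/w => size_F0.
  have : ((size (g \Po w)).-1 < q ^ 3 - q ^ 2)%N.
    by apply: leq_ltn_trans d_lt; rewrite -subn1 leq_subLR add1n.
  have -> : (q ^ 3 - q ^ 2 = q.-1 * (q * q))%N by rewrite -subn1 mulnBl mul1n mulnn -expnS.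
  by rewrite size_comp_poly size_w ltn_mul2r => /andP[].
have gS : {in [seq a <- s | a != 0], forall a, g.[a] = g.[1]}.
  move=> a; rewrite mem_filter sP => /andP[a0 aq].
  have [||c _ Fc] := @AGL2_invariant_ev3 K q F a 0 0 0 1 0 Finv (ltnW q_gt1).
  - by rewrite /= in_Fq0 in_Fq1 aq.
  - by rewrite mulr1 mulr0 subr0.
  (* The monomial [m] is free of [X], so [X -> aX] leaves its nonzero coefficient unchanged. *)
  have c1 : c = 1.
    have := congr1 (mcoeff m) (Fc _ (@mpolyC 3 K) 'X_i0 'X_i1 'X_i2).
    rewrite /= !mpolyC1 !mpolyC0 !mul0r !addr0 !mul1r !add0r ev3_mpolyX.
    rewrite !mul_mpolyC mcoeffZ mcoeff_ev3_scale m0 expr0 mulr1 -[LHS]mul1r.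
    by move/mulIf => ->.
  have := Fc _ polyC 'X 1 0.
  rewrite /= !polyC1 !polyC0 !mul0r !addr0 !mul1r !add0r c1 polyC1 mul1r => FcE.
  have wa : w \Po (a *: 'X) = a *: w.
    move/eqP: aq => aq.
    have -> : w = 'X^(q * q) - 'X^q.
      by rewrite /w comp_polyB comp_polyX comp_Xn_poly -exprM.
    by rewrite comp_polyB !comp_Xn_poly !exprZn exprM !aq scalerBr.
  have gw : (g \Po (a *: 'X)) \Po w = g \Po w.
    have FE : ev3 polyC 'X 1 0 F = g \Po w by rewrite gE comp_polyA.
    rewrite -[RHS]FE -FcE -[in LHS]comp_polyA comp_polyZ comp_polyX -wa comp_polyA -FE.
    rewrite (map_ev3 (h := polyC)) /= => [|b]; last by rewrite comp_polyC.
    by rewrite comp_polyX -!polyC1 -!polyC0 !comp_polyC mul_polyC.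
  have ga : g \Po (a *: 'X) = g.
    apply/eqP; rewrite -subr_eq0 -(comp_poly_eq0 _ (q := w)).
      by rewrite comp_polyB gw subrr.
    by rewrite -subn_gt0 subn1 size_w muln_gt0 ltnW.
  by rewrite -{2}ga horner_comp !hornerE.
exists g.[1].
have gC : g = g.[1]%:P.
  apply: (small_invariant_poly_const (S := [seq a <- s | a != 0])) => //.
    by rewrite filter_uniq.
  (* Removing 0 from [F_q] leaves [q - 1] points, more than the degree of [g]. *)
  have := count_predC (pred1 0) s; rewrite count_uniq_mem // sP in_Fq0 ss => sq.
  have -> : size [seq a <- s | a != 0] = q.-1 by rewrite -sq size_filter.
  by case: (size g) g_small.
by rewrite gE {1}gC !comp_polyC.
Qed.

(** The coordinate [X_i] divides [F], so the cofactor is constant by irreducibility. This serves for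
    both [X] and [Z]. *)
Lemma irred_plane_curve_dvd_X (F : {mpoly K[3]}) (d : nat) (i : 'I_3) :
  irred_plane_curve F d -> (forall m : 'X_{1..3}, m i = 0%N -> F@_m = 0) -> d = 1%N.
Proof.
move=> [F0 [Fd [_ Firr]]] /mpoly_factor_X[G FE].
have [|/eqP/msize_poly1P[c _ Gc]] := Firr _ _ FE.
  by rewrite msizeX mdeg1.
apply: (dhomog_uniq F0 Fd); rewrite FE Gc mulrC mul_mpolyC dhomogZ //.
by rewrite dhomogX; apply/eqP/mdeg1.
Qed.

Lemma AGL2_invariant_degree_ge (F : {mpoly K[3]}) (d : nat) :
  irred_plane_curve F d -> AGL2_invariant q F -> d <> 1%N -> (q ^ 3 - q ^ 2 <= d)%N.
Proof.
move=> Firr Finv d1; rewrite leqNgt; apply/negP => d_lt; apply: (d1).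
have [_ [Fd [F_gt1 _]]] := Firr.
have [[m mF /eqP m0]|noX] := @hasP _ (fun m : 'X_{1..3} => m i0 == 0%N) (msupp F); last first.
  apply: (irred_plane_curve_dvd_X (i := i0) Firr) => m m0; apply/eqP.
  by rewrite mcoeff_eq0; apply/negP => mF; apply: noX; exists m; rewrite ?m0.
have [c F0] : exists c, ev3 polyC 'X 1 0 F = c%:P.
  apply: (AGL2_invariant_line_at_infinity_const Finv Fd d_lt).
  by exists m; rewrite // -mcoeff_msupp.
(* The exchange of [X] and [Y] transfers constancy to the other chart. *)
have [||e e0 Fe] := @AGL2_invariant_ev3 K q F 0 1 0 1 0 0 Finv (ltnW q_gt1).
- by rewrite /= in_Fq0 in_Fq1.
- by rewrite mulr0 mulr1 sub0r oppr_eq0 oner_eq0.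
have F1 : ev3 polyC 1 'X 0 F = (e * c)%:P.
  have := Fe _ polyC 'X 1 0.
  by rewrite /= !polyC1 !polyC0 !mul0r !addr0 !mul1r !add0r F0 -polyCM.
have d_gt0 : (0 < d)%N.
  rewrite lt0n; apply: contraTneq F_gt1 => d0; rewrite -leqNgt msizeE.
  by apply/bigmax_leqP_seq => m' m'F _; move/dhomogP: Fd => /(_ _ m'F) ->; rewrite d0.
(* A surviving monomial without [Z] would be free of [X] by one chart and of [Y] by the other,
   contradicting [d > 0]. *)
apply: (irred_plane_curve_dvd_X (i := i2) Firr) => m' m'2.
have [m'd|m'd] := eqVneq (mdeg m') d; last exact: (dhomog_nemf_coeff Fd).
have := coef_line_at_infinity true Fd m'2 m'd; have := coef_line_at_infinity false Fd m'2 m'd.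
rewrite /= F0 F1 !coefC => <-; case: eqP => // m'1; case: eqP => [m'0|_ <- //].
by move: m'd d_gt0; rewrite mdegE big_ord3 /= m'0 m'1 m'2 => <-.
Qed.

End LowerBound.

(** * Uniqueness of Hensel lifts *)

Lemma poly_split_X (R : idomainType) (P : {poly R}) :
  P != 0 -> exists i P', P = 'X^i * P' /\ P'.[0] != 0.
Proof.
have [n] := ubnP (size P); elim: n P => // n IHn P; rewrite ltnS => sP P0.
have [P00|P00] := eqVneq P.[0] 0; last by exists 0%N, P; rewrite expr0 mul1r.
have /factor_theorem[Q PE] : root P 0 by rewrite rootE P00.
rewrite subr0 in PE.
have Q0 : Q != 0 by apply: contraNneq P0 => Q0; rewrite PE Q0 mul0r.
have [|i [P' [QE P'0]]] := IHn Q _ Q0.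
  by rewrite (leq_trans _ sP) // PE size_mulX.
by exists i.+1, P'; split; rewrite // PE QE exprS mulrC mulrA.
Qed.

Lemma polyX_expn_cancel (R : idomainType) (i j : nat) (P Q : {poly R}) :
  'X^i * P = 'X^j * Q -> P.[0] != 0 -> Q.[0] != 0 -> i = j /\ P = Q.
Proof.
wlog le_ij : i j P Q / (i <= j)%N.
  move=> H E P0 Q0; have [le_ij|/ltnW le_ji] := leqP i j; first exact: H.
  by have [-> ->] := H _ _ _ _ le_ji (esym E) Q0 P0.
move=> E P0 Q0; move: E; rewrite -(subnKC le_ij) exprD -mulrA.
have Xi : 'X^i != 0 :> {poly R} by rewrite expf_neq0 ?polyX_eq0.
move=> /(mulfI Xi) E; move: (P0); rewrite {1}E hornerM hornerXn expr0n.
have [ji _|_] := eqVneq (j - i)%N 0%N; last by rewrite mul0r eqxx.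
by split; [rewrite ji addn0 | rewrite E ji expr0 mul1r].
Qed.

(** At the first new index [j] the equality reduces to [(A_j - A'_j) B_0 = A_0 (B'_j - B_j)]. By
    coprimality [A_0] divides [A_j - A'_j], which is of smaller size and hence zero; then
    [B_j = B'_j] follows. *)
Lemma hensel_unique (K : fieldType) (A B A' B' : {poly {poly K}}) (N : nat) :
  A`_0 != 0 -> coprimep A`_0 B`_0 -> A'`_0 = A`_0 -> B'`_0 = B`_0 ->
  (forall j, (0 < j)%N -> (size (A`_j - A'`_j)%R < size (A`_0)%R)%N) ->
  (forall j, (j < N)%N -> (A * B)`_j = (A' * B')`_j) ->
  forall j, (j < N)%N -> A`_j = A'`_j /\ B`_j = B'`_j.
Proof.
move=> A0 copAB A'0 B'0 sA AB j; have [n] := ubnP j.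
elim: n j => // n IHn [|j]; rewrite ltnS => le_jn lt_jN; first by rewrite A'0 B'0.
(* Only the two extreme terms of each convolution involve new coefficients; the inner sums agree by
   induction. *)
have := AB _ lt_jN; rewrite !coefM big_ord_recl big_ord_recr /=.
rewrite [in RHS]big_ord_recl [in RHS]big_ord_recr /= !subn0 !subSS !subnn A'0 B'0.
rewrite -[bump 0 j]/j.+1.
set s := \sum_(i < j) _; set s' := \sum_(i < j) _.
have <- : s = s'.
  apply: eq_bigr => i _; have i_lt := ltn_ord i; rewrite -[bump 0 i]/i.+1 subSS.
  have [||-> _] := IHn i.+1; try by lia.
  by have [||_ ->] := IHn (j - i)%N; try by lia.
move/eqP; rewrite -subr_eq0 => /eqP E.
have {}E : (A`_j.+1 - A'`_j.+1) * B`_0 = A`_0 * (B'`_j.+1 - B`_j.+1).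
  by apply/eqP; rewrite -subr_eq0 -[X in _ == X]E; apply/eqP; ring.
have dA : A`_0 %| A`_j.+1 - A'`_j.+1.
  by rewrite -(Gauss_dvdpl _ copAB) E dvdp_mulr.
have AE : A`_j.+1 - A'`_j.+1 = 0.
  apply: contraTeq dA => d0; apply: contraL (sA j.+1 isT) => /(dvdp_leq d0).
  by rewrite leqNgt.
split; first by apply/eqP; rewrite -subr_eq0 AE.
move/esym/eqP: E; rewrite AE mul0r mulf_eq0 (negPf A0) /= subr_eq0.
by move/eqP.
Qed.

(** * The Dickson curve *)

(** Multiplicativity of the determinant with rows [(w, z)] and [(u, v)], meant for [w], [z] equal to
    Frobenius powers of [u], [v]. *)
Lemma wedge_linear (R : comPzRingType) (a b a' b' u v w z : R) :
  (a * w + b * z) * (a' * u + b' * v) - (a' * w + b' * z) * (a * u + b * v)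
  = (a * b' - b * a') * (w * v - z * u).
Proof. by ring. Qed.

Section DicksonCurve.

Variables (K : closedFieldType) (p k : nat).
Hypotheses (k_gt0 : (0 < k)%N) (pK : p \in [pchar K]).
Let q := (p ^ k)%N.
Let n := (q ^ 2 - q)%N.
Let N := (q ^ 3 - q ^ 2)%N.

Let q_gt1 : (1 < q)%N.
Proof. exact: pchar_expn_gt1 pK. Qed.

Let q2E : (q ^ 2 = p ^ (k * 2))%N.
Proof. by rewrite expnM. Qed.

Let q2_gt1 : (1 < q ^ 2)%N.
Proof. by rewrite -(exp1n 2) ltn_exp2r. Qed.

Let NE : N = (q * n)%N.
Proof. by rewrite /N /n mulnBr -!expnS mulnn. Qed.

Let nE : n = (q * q.-1)%N.
Proof. by rewrite /n -subn1 mulnBr muln1 mulnn. Qed.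

(** The product over [T] is the product over [F_(q^2)] divided by the one over [F_q]; the quotient
    is stated in multiplied form. *)
Lemma Fq2_minus_Fq_enum : exists T : seq K,
  [/\ uniq T, size T = n,
      forall t, (t \in T) = (t ^+ (q ^ 2) == t) && (t ^+ q != t) &
      forall (R : idomainType) (f : {rmorphism K -> R}) (u v : R),
        (\prod_(t <- T) (u - f t * v)) * (u ^+ q - v ^+ q.-1 * u)
        = u ^+ (q ^ 2) - v ^+ (q ^ 2).-1 * u].
Proof.
have [s [us ss sP]] := Fq_enum k_gt0 pK.
have q2_0 : (q ^ 2)%:R = 0 :> K by rewrite q2E; apply: pchar_natr_eq0; rewrite ?muln_gt0 ?k_gt0.
have [s2 [us2 ss2 sP2]] := fixed_points_expn q2_gt1 q2_0.
have ps : perm_eq [seq t <- s2 | t ^+ q == t] s.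
  apply: uniq_perm => //; first by rewrite filter_uniq.
  move=> t; rewrite mem_filter sP2 sP /in_Fq; case: eqP => //= tq.
  by rewrite -mulnn exprM !tq eqxx.
pose T := [seq t <- s2 | t ^+ q != t].
have ps2 : perm_eq s2 (T ++ s).
  by rewrite perm_sym perm_catC -(permPl (perm_cat ps (perm_refl T))) perm_filterC.
exists T; split.
- by rewrite filter_uniq.
- by rewrite /n -ss2 (perm_size ps2) size_cat ss addnK.
- by move=> t; rewrite mem_filter sP2 andbC.
move=> R f u v; rewrite -(prod_fixed_points f u v q_gt1 us ss sP).
by rewrite -(prod_fixed_points f u v q2_gt1 us2 ss2 sP2) (perm_big _ ps2) big_cat.
Qed.

(** In characteristic [p] this is additive in [x], and it vanishes at [x = az] for [a] in [F_q];
    translations by multiples of [Z] therefore do not affect [U] and [V]. *)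
Definition additive_form (S : pzRingType) (x z : S) : S := x ^+ q - z ^+ q.-1 * x.

Lemma rmorph_additive_form (S S' : pzRingType) (g : {rmorphism S -> S'}) x z :
  g (additive_form x z) = additive_form (g x) (g z).
Proof. by rewrite rmorphB rmorphM !rmorphXn. Qed.

Local Notation U := (additive_form 'X_i0 'X_i2 : {mpoly K[3]}).
Local Notation V := (additive_form 'X_i1 'X_i2 : {mpoly K[3]}).

Definition dickson_factor (t : K) : {mpoly K[3]} := U - t%:MP * V.

Definition dickson_curve (T : seq K) : {mpoly K[3]} :=
  \prod_(t <- T) dickson_factor t + 'X_i2 ^+ N.

Lemma ev3_factor (S : comNzRingType) (f : {rmorphism K -> S}) (x y z : S) (t : K) :
  ev3 f x y z (dickson_factor t) = additive_form x z - f t * additive_form y z.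
Proof. by rewrite rmorphB rmorphM /= !rmorph_additive_form /= !ev3X ev3C. Qed.

Lemma ev3_curve (S : comNzRingType) (f : {rmorphism K -> S}) (x y z : S) (T : seq K) :
  ev3 f x y z (dickson_curve T)
  = \prod_(t <- T) (additive_form x z - f t * additive_form y z) + z ^+ N.
Proof.
rewrite rmorphD rmorphXn rmorph_prod /= ev3X.
by congr (_ + _); apply: eq_bigr => t _; rewrite ev3_factor.
Qed.

Let expr_pred_q (e : K) : e != 0 -> e ^+ q = e -> e ^+ q.-1 = 1.
Proof. by move=> e0 eq; apply: (mulfI e0); rewrite -exprS prednK ?eq ?mulr1 // ltnW. Qed.

(** Frobenius fixes the coefficients, [e^(q-1) = 1], and the two terms [c z^q] cancel. Thus a matrix
    acts on [(U, V)] through its linear part. *)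
Lemma additive_form_affine (S : comNzRingType) (f : {rmorphism K -> S}) (x y z : S)
    (a b c e : K) :
  a ^+ q = a -> b ^+ q = b -> c ^+ q = c -> e != 0 -> e ^+ q = e ->
  additive_form (f a * x + (f b * y + f c * z)) (f e * z)
  = f a * additive_form x z + f b * additive_form y z.
Proof.
move=> aq bq cq e0 eq.
have pS : p \in [pchar S] by rewrite (rmorph_pchar f).
rewrite /additive_form !expq_D // !exprMn -!rmorphXn aq bq cq expr_pred_q // rmorph1 mul1r.
have -> : z ^+ q = z ^+ q.-1 * z by rewrite -exprSr prednK // ltnW.
by ring.
Qed.

Let homXn i m : 'X_i ^+ m \is [in K[3], m.-homog].
Proof.
have X1 : 'X_i \is [in K[3], 1.-homog] by rewrite dhomogX; apply/eqP/mdeg1.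
by have := dhomogMn m X1; rewrite mul1n.
Qed.

Lemma dickson_factors_homog (T : seq K) :
  \prod_(t <- T) dickson_factor t \is (size T * q).-homog.
Proof.
have homU i : additive_form 'X_i 'X_i2 \is [in K[3], q.-homog].
  rewrite dhomogD ?homXn // dhomogN.
  by have := dhomogM (homXn i2 q.-1) (homXn i 1); rewrite addn1 prednK // ltnW.
elim: T => [|t T IHT]; first by rewrite big_nil dhomog1.
rewrite big_cons mulSn dhomogM // dhomogD ?homU // dhomogN mul_mpolyC.
exact/dhomogZ/homU.
Qed.

Lemma dickson_curve_homog (T : seq K) : size T = n -> dickson_curve T \is N.-homog.
Proof.
by move=> sT; rewrite dhomogD ?homXn // NE mulnC -sT dickson_factors_homog.
Qed.

Lemma dickson_curve_invariant (T : seq K) :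
  (forall (u v : {mpoly K[3]}),
     (\prod_(t <- T) (u - t%:MP * v)) * (u ^+ q - v ^+ q.-1 * u)
     = u ^+ (q ^ 2) - v ^+ (q ^ 2).-1 * u) ->
  AGL2_invariant q (dickson_curve T).
Proof.
move=> prodT M [Mq [Munit [M20 M21]]].
exists 1; split; first exact: oner_neq0.
rewrite scale1r -[LHS]ev3_mpolyX ev3_act M20 M21 !rmorph0 !mul0r !add0r ev3_curve.
have detM : M i2 i2 * (M i0 i0 * M i1 i1 - M i0 i1 * M i1 i0) != 0.
  by rewrite -det3_affine // -unitfE -unitmxE.
move: detM; rewrite mulf_eq0 negb_or => /andP[M22 detM].
have Mq' i j : M i j ^+ q = M i j by apply/eqP/Mq.
rewrite !additive_form_affine //.
rewrite /dickson_curve; congr (_ + _); last first.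
  (* The exponent [N] is a multiple of [q - 1]. *)
  rewrite exprMn -rmorphXn (_ : M _ _ ^+ N = 1) ?mul1r //.
  by rewrite NE nE mulnA mulnC exprM expr_pred_q ?expr1n.
set a := M i0 i0; set b := M i0 i1; set a' := M i1 i0; set b' := M i1 i1.
pose L (u v : {mpoly K[3]}) := u ^+ q * v - v ^+ q * u.
pose D (u v : {mpoly K[3]}) := u ^+ (q ^ 2) * v - v ^+ (q ^ 2) * u.
(* Multiplying by [v] turns both sides of the hypothesis into determinants. *)
have prodL u v : (\prod_(t <- T) (u - t%:MP * v)) * L u v = D u v.
  have := congr1 ( *%R^~ v) (prodT u v); rewrite -mulrA !mulrBl ![_ * u * v]mulrAC.
  by rewrite -!exprSr !prednK // ltnW.
have pS : p \in [pchar {mpoly K[3]}] by rewrite (rmorph_pchar (@mpolyC 3 K)).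
have L' u v : L (a%:MP * u + b%:MP * v) (a'%:MP * u + b'%:MP * v)
    = (a * b' - b * a')%:MP * L u v.
  rewrite /L !expq_D // -/q !exprMn -!rmorphXn /= !Mq' rmorphB !rmorphM /=.
  exact: wedge_linear.
have D' u v : D (a%:MP * u + b%:MP * v) (a'%:MP * u + b'%:MP * v)
    = (a * b' - b * a')%:MP * D u v.
  rewrite /D q2E !expq_D ?muln_gt0 ?k_gt0 // !exprMn -!rmorphXn /=.
  rewrite -!q2E -mulnn !exprM !Mq' rmorphB !rmorphM /=.
  exact: wedge_linear.
set u := additive_form _ _; set v := additive_form _ _.
have L0 : L u v != 0.
  (* At [Y = 1], [Z = 0] this determinant becomes [X^(q^2) - X^q]. *)
  apply/eqP => /(congr1 (ev3 polyC 'X 1 0)).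
  rewrite rmorph0 rmorphB !rmorphM !rmorphXn /= /u /v !rmorph_additive_form /= !ev3X.
  rewrite /additive_form expr1n expr0n gtn_eqF ?ltn_predRL // !mul0r !subr0.
  rewrite expr1n mul1r mulr1 -exprM => /eqP; rewrite subr_eq0 => /eqP/(congr1 (size \o polyseq)) /=.
  rewrite !size_polyXn => -[/eqP]; rewrite -[X in _ == X]muln1 eqn_pmul2l ?(ltnW q_gt1) //.
  by rewrite gtn_eqF.
apply: (mulIf (x := L (a%:MP * u + b%:MP * v) (a'%:MP * u + b'%:MP * v))).
  by rewrite L' mulf_eq0 negb_or L0 mpolyC_eq0 detM.
by rewrite prodL D' L' mulrCA prodL.
Qed.

Variable T : seq K.
Hypotheses (uT : uniq T) (sT : size T = n).
Hypothesis (memT : forall t, (t \in T) = (t ^+ (q ^ 2) == t) && (t ^+ q != t)).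

Local Notation curve := (dickson_curve T).
Local Notation factor := dickson_factor.

Let q1_gt0 : (0 < q.-1)%N.
Proof. by rewrite ltn_predRL. Qed.

Let q_gt0 : (0 < q)%N.
Proof. exact: ltnW. Qed.

Let n_gt0 : (0 < n)%N.
Proof. by rewrite nE muln_gt0 q_gt0. Qed.

Let memTq t : t \in T -> t ^+ q ^+ q = t.
Proof. by rewrite memT -exprM mulnn => /andP[/eqP]. Qed.

Let pX (S : comNzRingType) (f : {rmorphism K -> S}) : p \in [pchar S].
Proof. by rewrite (rmorph_pchar f). Qed.

(** * Local behaviour at the points at infinity *)

Definition infinity_part : {mpoly K[3]} -> {poly K} := ev3 polyC 'X 1 0.
HB.instance Definition _ := GRing.RMorphism.copy infinity_part (ev3 polyC 'X 1 0).

(* [X] is the inner variable and [Z] the outer one. *)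
Definition affine_part : {mpoly K[3]} -> {poly {poly K}} :=
  ev3 (polyC \o polyC) 'X%:P 1 'X.
HB.instance Definition _ := GRing.RMorphism.copy affine_part
  (ev3 (polyC \o polyC) 'X%:P 1 'X).

(* The exponents of [s], the outer variable, are the weights adapted to an edge of
   slope [q/(q-1)] of the Newton polygon at [(t : 1 : 0)]. *)
Definition newton_subst (t : K) : {mpoly K[3]} -> {poly {poly K}} :=
  ev3 (polyC \o polyC) (t%:P%:P + 'X%:P * 'X^(q.-1)) 1 'X^q.
HB.instance Definition _ t := GRing.RMorphism.copy (newton_subst t)
  (ev3 (polyC \o polyC) (t%:P%:P + 'X%:P * 'X^(q.-1)) 1 'X^q).

Lemma coef0_affine_part F : (affine_part F)`_0 = infinity_part F.
Proof.
rewrite -horner_coef0 -/(horner_eval 0 (affine_part F)).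
rewrite /affine_part (map_ev3 (h := polyC)) => [|c]; last exact: hornerC.
by rewrite rmorph1 /= /horner_eval hornerX hornerC.
Qed.

Lemma newton_subst0 t F : (newton_subst t F).[0] = ((infinity_part F).[t])%:P.
Proof.
rewrite -/(horner_eval 0 _) /newton_subst (map_ev3 (h := polyC)) => [|c]; last exact: hornerC.
have -> : (infinity_part F).[t]%:P = ev3 polyC t%:P 1 0 F.
  rewrite -[LHS]/((polyC \o horner_eval t) _) /infinity_part (map_ev3 (h := polyC)) => [|c].
    by rewrite /= /horner_eval hornerX !hornerC.
  by rewrite /= /horner_eval hornerC.
rewrite /= /horner_eval !hornerE !expr0n !gtn_eqF //=.
by rewrite mulr0 addr0.
Qed.

Lemma size_affine_part F j : (size ((affine_part F)`_j)%R <= msize F - j)%N.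
Proof.
rewrite /affine_part ev3E coef_sum; apply: (leq_trans (size_sum _ _ _)).
apply/bigmax_leqP_seq => m mF _; have := msize_mdeg_lt mF; rewrite mdegE big_ord3 /= => m_lt.
rewrite expr1n mul1r -rmorphXn mulrA -polyCM coefCM coefXn mul_polyC.
case: eqP => [->|_]; last by rewrite mulr0 size_poly0.
rewrite mulr1; apply: (leq_trans (size_scale_leq _ _)).
rewrite size_polyXn ltn_subRL; apply: leq_ltn_trans m_lt.
by rewrite addnC leq_add2l leq_addl.
Qed.

(** In [newton_subst] each [x] carries [s^(q-1)] and each [Z] becomes [s^q], so a term [s^i x^j] has
    [i] in [(q-1) j + q NN]. This records the lattice points of the Newton polygon. *)
Let graded (P : {poly {poly K}}) :=
  forall i j, P`_i`_j != 0 -> exists l, i = (q.-1 * j + q * l)%N.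

Let gradedM P Q : graded P -> graded Q -> graded (P * Q).
Proof.
move=> gP gQ i j; rewrite coefM coef_sum => nz.
have [/existsP[a]|] := boolP [exists a : 'I_i.+1, (P`_a * Q`_(i - a))`_j != 0]; last first.
  rewrite negb_exists => /forallP h; move: nz; rewrite big1 ?eqxx // => a _.
  by apply/eqP; rewrite -[_ == _]negbK.
rewrite coefM => nz'.
have [/existsP[b]|] := boolP [exists b : 'I_j.+1, P`_a`_b * Q`_(i - a)`_(j - b) != 0]; last first.
  rewrite negb_exists => /forallP h; move: nz'; rewrite big1 ?eqxx // => b _.
  by apply/eqP; rewrite -[_ == _]negbK.
rewrite mulf_eq0 negb_or => /andP[/gP[l1 e1] /gQ[l2 e2]].
exists (l1 + l2)%N; have a_lt := ltn_ord a; have b_lt := ltn_ord b.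
have ei : i = (a + (i - a))%N by rewrite subnKC.
have ej : j = (b + (j - b))%N by rewrite subnKC.
by rewrite [LHS]ei [in RHS]ej e2 e1 !mulnDr addnACA.
Qed.

Let gradedX P m : graded P -> graded (P ^+ m).
Proof.
move=> gP; elim: m => [|m IHm]; last by rewrite exprS; apply: gradedM.
move=> i j; rewrite expr0 coef1; have [->|_] := eqVneq i 0%N; last by rewrite coef0 eqxx.
rewrite coef1; have [->|_] := eqVneq j 0%N; last by rewrite eqxx.
by exists 0%N; rewrite !muln0.
Qed.

Let graded_newton t F : graded (newton_subst t F).
Proof.
rewrite /newton_subst ev3E => i j; rewrite !coef_sum => nz.
have [/hasP[m mF]|] := boolP (has (fun m => (((polyC \o polyC) F@_m *
   ((t%:P%:P + 'X%:P * 'X^(q.-1)) ^+ m i0 * (1 ^+ m i1 * 'X^q ^+ m i2)))`_i)`_j != 0)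
   (msupp F)); last first.
  move/hasPn => h; move: nz; rewrite big1_seq ?eqxx // => m /andP[_ /h].
  by rewrite negbK => /eqP.
have gC c : graded c%:P%:P.
  move=> a b; rewrite coefC; have [->|_] := eqVneq a 0%N; last by rewrite coef0 eqxx.
  rewrite coefC; have [->|_] := eqVneq b 0%N; last by rewrite eqxx.
  by exists 0%N; rewrite !muln0.
apply: gradedM; first exact: gC.
apply: gradedM; first apply: gradedX.
  move=> a b; rewrite coefD coefC coefCM coefXn.
  have [->|a0] := eqVneq a 0%N.
    rewrite (ltn_eqF q1_gt0) mulr0 addr0 coefC.
    have [->|_] := eqVneq b 0%N; last by rewrite eqxx.
    by exists 0%N; rewrite !muln0.
  rewrite add0r; have [->|_] := eqVneq a q.-1; last by rewrite mulr0 coef0 eqxx.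
  rewrite mulr1 coefX; have [-> _|_] := eqVneq b 1%N; last by rewrite eqxx.
  by exists 0%N; rewrite muln0 muln1 addn0.
rewrite expr1n mul1r; apply: gradedX => a b; rewrite coefXn.
have [->|_] := eqVneq a q; last by rewrite coef0 eqxx.
rewrite coef1; have [->|_] := eqVneq b 0%N; last by rewrite eqxx.
by exists 1%N; rewrite muln0 muln1.
Qed.

(** The restriction is [X^q - t], and [t] is the [q]-th power of [t^q] because [t] lies in
    [F_(q^2)]. *)
Lemma infinity_part_factor t :
  t \in T -> infinity_part (factor t) = ('X - (t ^+ q)%:P) ^+ q.
Proof.
move=> tT; rewrite /infinity_part ev3_factor /additive_form.
rewrite expr1n expr0n gtn_eqF // !mul0r !subr0 mulr1.
by rewrite (expq_B _ _ _ (pX polyC)) // -/q -rmorphXn /= memTq.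
Qed.

Lemma infinity_part_curve :
  infinity_part curve = \prod_(t <- T) ('X - (t ^+ q)%:P) ^+ q.
Proof.
rewrite rmorphD rmorph_prod rmorphXn /= [X in X ^+ N](_ : _ = 0); last first.
  by rewrite /infinity_part ev3X.
rewrite expr0n gtn_eqF ?NE ?muln_gt0 ?q_gt0 // addr0.
by apply: eq_big_seq => t /infinity_part_factor.
Qed.

(** At [(t^q : 1 : 0)] the factor of [t] has order [n] in [s], while every other factor has the
    nonzero value [t - t'] at [s = 0]. The polynomial [C.[0]] is the edge polynomial. *)
Lemma newton_factorization t : t \in T ->
  exists2 C : {poly {poly K}}, newton_subst (t ^+ q) curve = 'X^n * C &
  exists2 c : K, c != 0 & C.[0] = c *: ('X^q - (t ^+ q - t)%:P).
Proof.
move=> tT; set tau := t ^+ q.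
pose R := {poly {poly K}}; pose x : R := 'X%:P; pose s : R := 'X.
pose f : {rmorphism K -> R} := polyC \o polyC.
pose u := additive_form (f tau + x * s ^+ q.-1) (s ^+ q).
pose v := additive_form 1 (s ^+ q).
have sE : (s ^+ q) ^+ q.-1 = s ^+ n by rewrite -exprM nE.
have nE2 : s ^+ q.-1 ^+ q = s ^+ n by rewrite -exprM mulnC nE.
have uE : u = f t + s ^+ n * (x ^+ q - f tau - x * s ^+ q.-1).
  rewrite /u /additive_form sE expq_D ?pX // exprMn nE2 -rmorphXn /= memTq //.
  by ring.
have vE : v = 1 - s ^+ n by rewrite /v /additive_form sE expr1n mulr1.
have utE : u - f t * v = s ^+ n * (x ^+ q - f (tau - t) - x * s ^+ q.-1).
  by rewrite uE vE rmorphB; ring.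
pose P := \prod_(t' <- rem t T) (u - f t' * v).
exists ((x ^+ q - f (tau - t) - x * s ^+ q.-1) * P + s ^+ (q * N - n)).
  have -> : newton_subst tau curve = \prod_(t' <- T) (u - f t' * v) + (s ^+ q) ^+ N.
    exact: ev3_curve.
  rewrite (big_rem t) //= -/P.
  rewrite [RHS]mulrDr mulrA utE; congr (_ + _).
  rewrite -exprD -exprM subnKC //.
  by rewrite (leq_trans (leq_pmull n q_gt0)) // leq_mul2l NE leq_pmull ?orbT.
have s0 m : (0 < m)%N -> (s ^+ m).[0] = 0.
  by move=> m_gt0; rewrite hornerXn expr0n gtn_eqF.
have f0 c : (f c).[0] = c%:P by exact: hornerC.
exists (\prod_(t' <- rem t T) (t - t')).
  rewrite prodf_seq_neq0; apply/allP => t'; rewrite mem_rem_uniq // inE => /andP[t't _].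
  by rewrite subr_eq0 eq_sym.
have uv0 t' : (u - f t' * v).[0] = (t - t')%:P.
  rewrite uE vE !(hornerD, hornerN, hornerM) !f0 s0 // polyC1 mul0r addr0 subr0 mulr1.
  by rewrite polyCB.
(* The term from [Z^N] has order [qN > n], so it does not reach the edge. *)
rewrite hornerD s0; last first.
  by rewrite subn_gt0 NE mulnA ltn_Pmull // (ltn_mul q_gt1 q_gt1).
rewrite addr0 hornerM horner_prod (eq_bigr (fun t' => (t - t')%:P)) => [|t' _]; last exact: uv0.
rewrite -rmorph_prod /= mulrC mul_polyC; congr (_ *: _).
rewrite !(hornerD, hornerN, hornerM) f0 s0 // mulr0 subr0 horner_exp.
by rewrite hornerC.
Qed.

(** Split off [s^i] and [s^j] from the images of [A] and [B], so [i + j = n]. The constant term of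
    [A'.[0]] gives [q | i]; its leading term, of degree [r], then gives [q | (q-1) r], so [r] is 0
    or [q]. The factor carrying degree [q] absorbs all of [s^n], and the other is nonzero at the
    point. *)
Lemma infinity_factors_coprime_at t A B : t \in T -> curve = A * B ->
  (infinity_part A).[t ^+ q] != 0 \/ (infinity_part B).[t ^+ q] != 0.
Proof.
move=> tT curveE; have [C CE [c c0 C0]] := newton_factorization tT.
set tau := t ^+ q in CE C0 *.
(* This is where [t] outside [F_q] matters: the edge polynomial has a nonzero constant term. *)
have e0 : tau - t != 0 by move: tT; rewrite memT subr_eq0 => /andP[].
have C0nz : C.[0] != 0.
  rewrite C0 scaler_eq0 negb_or c0 -size_poly_eq0 size_polyDl ?size_polyXn //.
  by rewrite size_polyN ltnS; apply: (leq_trans (size_polyC_leq1 _)).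
have nz : newton_subst tau A * newton_subst tau B != 0.
  rewrite -rmorphM /= -curveE CE mulf_eq0 negb_or expf_neq0 ?polyX_eq0 //=.
  by apply: contraNneq C0nz => ->; rewrite horner0.
move: nz; rewrite mulf_eq0 negb_or => /andP[/poly_split_X[i [A' [AE A'0]]]].
move=> /poly_split_X[j [B' [BE B'0]]].
have [ij ABC] : (i + j)%N = n /\ A' * B' = C.
  apply: polyX_expn_cancel; rewrite // ?hornerM ?mulf_neq0 //.
  by rewrite -CE curveE rmorphM /= AE BE exprD mulrACA.
have coefA r : (A'.[0])`_r != 0 -> exists l, i = (q.-1 * r + q * l)%N.
  move=> nz; apply: (@graded_newton tau A).
  by rewrite AE coefXnM ltnn subnn -horner_coef0.
have coefB r : (B'.[0])`_r != 0 -> exists l, j = (q.-1 * r + q * l)%N.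
  move=> nz; apply: (@graded_newton tau B).
  by rewrite BE coefXnM ltnn subnn -horner_coef0.
have AB0 : A'.[0] * B'.[0] = c *: ('X^q - (tau - t)%:P) by rewrite -hornerM ABC C0.
have [lA0 iE0] : exists l, i = (q.-1 * 0 + q * l)%N.
  apply: coefA; rewrite -horner_coef0.
  have /(congr1 (horner^~ 0)) := AB0.
  rewrite hornerM hornerZ hornerD hornerN hornerXn hornerC expr0n gtn_eqF // sub0r => E.
  by apply: contraNneq (mulf_neq0 c0 e0) => A0; move/eqP: E; rewrite A0 mul0r mulrN eq_sym oppr_eq0.
have size_AB : (size A'.[0] + size B'.[0] = q.+2)%N.
  have : size (A'.[0] * B'.[0]) = q.+1.
    by rewrite AB0 size_scale // size_polyDl ?size_polyXn // size_polyN ltnS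
      (leq_trans (size_polyC_leq1 _)).
  rewrite size_mul // => <-; rewrite prednK // addn_gt0 size_poly_gt0.
  by rewrite A'0.
have [lA iE] : exists l, i = (q.-1 * (size A'.[0]).-1 + q * l)%N.
  by apply: coefA; rewrite -/(lead_coef _) lead_coef_eq0.
have [lB jE] : exists l, j = (q.-1 * (size B'.[0]).-1 + q * l)%N.
  by apply: coefB; rewrite -/(lead_coef _) lead_coef_eq0.
have sA0 : (0 < size A'.[0])%N by rewrite size_poly_gt0.
have sB0 : (0 < size B'.[0])%N by rewrite size_poly_gt0.
set r := (size A'.[0]).-1 in iE; set r' := (size B'.[0]).-1 in jE.
have rr' : (r + r' = q)%N.
  move: size_AB sA0 sB0; rewrite /r /r'; case: (size _) => // a; case: (size _) => // b.
  by rewrite addSn addnS => -[].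
have q_dvd_r : (q %| r)%N.
  have : (q %| q.-1 * r + q * lA)%N by rewrite -iE iE0 muln0 add0n dvdn_mulr.
  rewrite (dvdn_addl _ (dvdn_mulr lA (dvdnn q))) Gauss_dvdr //.
  by rewrite -{1}(prednK q_gt0) coprimeSn.
have zero P P' h : newton_subst tau P = 'X^h * P' -> P'.[0] != 0 -> h = 0%N ->
    (infinity_part P).[tau] != 0.
  by move=> PE P'0 h0; rewrite -polyC_eq0 -newton_subst0 PE h0 expr0 mul1r.
have [r0|r_gt0] := posnP r.
  left; apply: (zero _ _ _ AE A'0).
  (* Here [r' = q], so [j >= (q-1) q = n] and [i = 0]. *)
  suff : (n <= j)%N by rewrite -ij -[X in (_ <= X)%N]add0n leq_add2r leqn0 => /eqP.
  by rewrite jE -[r']add0n -r0 rr' mulnC -nE leq_addr.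
right; apply: (zero _ _ _ BE B'0).
suff : (n <= i)%N by rewrite -ij -[X in (_ <= X)%N]addn0 leq_add2l leqn0 => /eqP.
have rq : r = q.
  by apply/eqP; rewrite eqn_leq (dvdn_leq r_gt0 q_dvd_r) -{1}rr' leq_addr.
by rewrite iE rq mulnC -nE leq_addr.
Qed.

(** * Irreducibility by comparison of Hensel lifts *)

Lemma dickson_curve_irreducible : mirreducible curve.
Proof.
have homF := dickson_curve_homog sT.
have N_gt0 : (0 < N)%N by rewrite NE muln_gt0 q_gt0.
have infE := infinity_part_curve.
have size_inf S : size (\prod_(t <- S) ('X - (t ^+ q)%:P) ^+ q : {poly K}) = (size S * q).+1.
  elim: S => [|t S IHS]; first by rewrite big_nil size_poly1.
  rewrite big_cons size_mul ?IHS ?size_exp_XsubC ?expf_neq0 ?polyXsubC_eq0 //.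
    by rewrite mulSn addSn addnS.
  by rewrite -size_poly_gt0 IHS.
have inf0 : infinity_part curve != 0 by rewrite infE -size_poly_gt0 size_inf.
have F0 : curve != 0 by apply: contraNneq inf0 => ->; rewrite rmorph0.
have msizeF : (msize curve <= N.+1)%N.
  rewrite msizeE; apply/bigmax_leqP_seq => m mF _.
  by move/dhomogP: homF => /(_ _ mF) ->.
split.
  have mF := mlead_supp F0; apply: leq_ltn_trans (msize_mdeg_lt mF).
  by move/dhomogP: homF => /(_ _ mF) ->.
move=> A B curveE.
have AB0 : (A != 0) && (B != 0).
  by move: F0; rewrite curveE mulf_eq0 negb_or.
case/andP: AB0 => A0 B0.
have infAB : infinity_part A * infinity_part B = \prod_(t <- T) ('X - (t ^+ q)%:P) ^+ q.
  by rewrite -infE curveE rmorphM.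
have : (infinity_part A != 0) && (infinity_part B != 0).
  by rewrite -negb_or -mulf_eq0 infAB -infE.
case/andP => iA0 iB0.
have sizeAB : (size (infinity_part A) + size (infinity_part B) = N.+2)%N.
  have := size_inf T; rewrite -infAB size_mul // sT mulnC -NE.
  by move: iA0; rewrite -size_poly_gt0; case: (size _) => // a _; rewrite addSn /= => ->.
have sA : (size (infinity_part A) <= msize A)%N.
  by rewrite -coef0_affine_part -[X in (_ <= X)%N]subn0 size_affine_part.
have sB : (size (infinity_part B) <= msize B)%N.
  by rewrite -coef0_affine_part -[X in (_ <= X)%N]subn0 size_affine_part.
have msizeAB : (msize A + msize B <= N.+2)%N.
  by move: msizeF; rewrite curveE msizeM // -subn1 leq_subLR add1n.
(* The restrictions already account for the whole degree [N], so neither factor drops degree on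
   [Z = 0]. *)
have [{}sA {}sB] : size (infinity_part A) = msize A /\ size (infinity_part B) = msize B.
  split; apply/eqP; rewrite eqn_leq ?sA ?sB /=.
    by rewrite -(leq_add2r (size (infinity_part B))) sizeAB (leq_trans _ msizeAB) ?leq_add2l.
  by rewrite -(leq_add2l (size (infinity_part A))) sizeAB (leq_trans _ msizeAB) ?leq_add2r.
have [A_le1|A_gt1] := leqP (msize A) 1.
  by left; apply/eqP; rewrite eqn_leq A_le1 -sA size_poly_gt0.
have [B_le1|B_gt1] := leqP (msize B) 1.
  by right; apply/eqP; rewrite eqn_leq B_le1 -sB size_poly_gt0.
(* As [msize] is the degree plus one, nonconstant factors have degree below [N], hence no
   coefficient of [Z^j] with [j >= N]. *)
have A_leN : (msize A <= N)%N.
  by rewrite -(leq_add2r 2) [(N + 2)%N]addn2 (leq_trans _ msizeAB) // leq_add2l.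
have B_leN : (msize B <= N)%N.
  by rewrite -(leq_add2l 2) [(2 + N)%N]add2n (leq_trans _ msizeAB) // leq_add2r.
exfalso.
(* The points at infinity are divided into those on [A] and the rest; by the local lemma [B] avoids
   the former. *)
pose S := [seq t <- T | root (infinity_part A) (t ^+ q)].
pose S' := [seq t <- T | ~~ root (infinity_part A) (t ^+ q)].
pose PS (S : seq K) : {poly K} := \prod_(t <- S) ('X - (t ^+ q)%:P) ^+ q.
have permT : perm_eq (S ++ S') T by rewrite perm_filterC.
have PST : PS S * PS S' = PS T by rewrite /PS -big_cat (perm_big _ permT).
have copA : coprimep (infinity_part A) (PS S').
  rewrite /PS big_seq; elim/big_ind: _ => [|x y cx cy|t]; rewrite ?coprimep1 ?coprimepMr ?cx //.
  by rewrite mem_filter => /andP[rt _]; rewrite coprimep_expr // coprimep_XsubC.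
have copB : coprimep (infinity_part B) (PS S).
  rewrite /PS big_seq; elim/big_ind: _ => [|x y cx cy|t]; rewrite ?coprimep1 ?coprimepMr ?cx //.
  rewrite mem_filter => /andP[rt tT]; rewrite coprimep_expr // coprimep_XsubC rootE.
  have [] := infinity_factors_coprime_at tT curveE; last by [].
  by move: rt; rewrite rootE => /eqP->; rewrite eqxx.
have dA : PS S %| infinity_part A.
  by rewrite -(Gauss_dvdpl _ (_ : coprimep _ (infinity_part B))) 1?coprimep_sym // infAB -/(PS T) -PST dvdp_mulr.
have dB : PS S' %| infinity_part B.
  by rewrite -(Gauss_dvdpr _ (_ : coprimep _ (infinity_part A))) 1?coprimep_sym // infAB -/(PS T) -PST dvdp_mull.
have PS0 S1 : PS S1 != 0 by rewrite -size_poly_gt0 size_inf.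
move/dvdpP: dA => [e iAE]; move/dvdpP: dB => [f iBE].
have ef : e * f = 1.
  apply: (mulIf (PS0 T)); rewrite mul1r -{1}PST -/(PS T) -[RHS]infAB iAE iBE.
  by rewrite mulrACA.
have [e0 f0] : e != 0 /\ f != 0.
  by split; apply: contraNneq (oner_neq0 {poly K}) => E; rewrite -ef E ?mul0r ?mulr0.
have size_ef : (size e + size f = 2)%N.
  have := size_mul e0 f0; rewrite ef size_poly1.
  move: e0 f0; rewrite -!size_poly_gt0; case: (size e) (size f) => [|a] [|b] //.
  by rewrite addSn addnS => _ _ [<-].
move: e0 f0; rewrite -!size_poly_gt0 => e_gt0 f_gt0.
have [eps [phi [epsE phiE]]] : exists eps phi, e = eps%:P /\ f = phi%:P.
  exists e`_0, f`_0; split; apply: size1_polyC.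
    by rewrite -(leq_add2r (size f)) size_ef.
  by rewrite -(leq_add2l (size e)) size_ef addn1.
have eps0 : eps != 0 by rewrite -polyC_eq0 -epsE -size_poly_gt0.
have phi0 : phi != 0 by rewrite -polyC_eq0 -phiE -size_poly_gt0.
have epsphi : eps * phi = 1.
  by apply: polyC_inj; rewrite polyCM -epsE -phiE ef.
(* The competing lifts: partial products of the factors, scaled to have the same restrictions as [A]
   and [B]. *)
pose A' := eps%:MP * \prod_(t <- S) factor t.
pose B' := phi%:MP * \prod_(t <- S') factor t.
have AB' : A' * B' = \prod_(t <- T) factor t.
  by rewrite /A' /B' mulrACA -mpolyCM epsphi mul1r -big_cat (perm_big _ permT).
have infA' : infinity_part A' = infinity_part A.
  rewrite iAE epsE rmorphM rmorph_prod /= [infinity_part _%:MP]ev3C.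
  congr (_ * _); apply: eq_big_seq => t; rewrite mem_filter => /andP[_].
  exact: infinity_part_factor.
have infB' : infinity_part B' = infinity_part B.
  rewrite iBE phiE rmorphM rmorph_prod /= [infinity_part _%:MP]ev3C.
  congr (_ * _); apply: eq_big_seq => t; rewrite mem_filter => /andP[_].
  exact: infinity_part_factor.
have msize_le S1 c G : G = c%:MP * \prod_(t <- S1) factor t -> (msize G <= size (PS S1))%N.
  move=> ->; rewrite size_inf msizeE; apply/bigmax_leqP_seq => m mF _.
  have : c%:MP * \prod_(t <- S1) factor t \is (size S1 * q).-homog.
    by rewrite mul_mpolyC dhomogZ // dickson_factors_homog.
  by move/dhomogP => /(_ _ mF) ->.
have sA' : (msize A' <= msize A)%N.
  rewrite -sA iAE epsE mul_polyC size_scale //; exact: msize_le.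
have sB' : (msize B' <= msize B)%N.
  rewrite -sB iBE phiE mul_polyC size_scale //; exact: msize_le.
have coef_eq0 G j : (msize G <= j)%N -> (affine_part G)`_j = 0.
  move=> Gj; apply/eqP; rewrite -size_poly_leq0.
  by rewrite (leq_trans (size_affine_part _ _)) // leqn0 subn_eq0.
have affF : affine_part A * affine_part B = affine_part A' * affine_part B' + 'X^N.
  rewrite -!rmorphM AB' /= -curveE [LHS]rmorphD; congr (_ + _).
  by rewrite rmorphXn /= [affine_part 'X_i2]ev3X.
have coefs j : (j < N)%N ->
    (affine_part A)`_j = (affine_part A')`_j /\ (affine_part B)`_j = (affine_part B')`_j.
  apply: hensel_unique; rewrite ?coef0_affine_part //.
  - by rewrite iBE phiE mul_polyC coprimepZr.
  (* The coefficient of [Z^i] loses at least [i] in size, whereas that of [Z^0] has full size. *)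
  - move=> i i_gt0; rewrite sA (leq_ltn_trans (size_polyD _ _)) // size_polyN.
    rewrite gtn_max !(leq_ltn_trans (size_affine_part _ _)) //.
      by rewrite (leq_ltn_trans (leq_sub2r _ sA')) // ltn_subrL i_gt0 ltnW.
    by rewrite ltn_subrL i_gt0 ltnW.
  - by move=> i i_lt; rewrite affF coefD coefXn ltn_eqF // addr0.
have AA' : affine_part A = affine_part A'.
  apply/polyP => j; have [/coefs[]//|le_Nj] := ltnP j N.
  by rewrite !coef_eq0 // ?(leq_trans sA') ?(leq_trans A_leN).
have BB' : affine_part B = affine_part B'.
  apply/polyP => j; have [/coefs[]//|le_Nj] := ltnP j N.
  by rewrite !coef_eq0 // ?(leq_trans sB') ?(leq_trans B_leN).
(* Both factorizations have the same product, leaving [Z^N = 0]. *)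
move/eqP: affF; rewrite AA' BB' -subr_eq0 opprD addrA subrr sub0r oppr_eq0.
by rewrite expf_eq0 polyX_eq0 andbF.
Qed.

End DicksonCurve.

Theorem mainTheorem1 (K : closedFieldType) (p k : nat) :
  prime p -> (0 < k)%N -> p \in [pchar K] -> algebraic_over_prime_field K ->
  let q := (p ^ k)%N in
  (forall (F : {mpoly K[3]}) (d : nat),
      irred_plane_curve F d -> AGL2_invariant q F -> d <> 1%N ->
      (q ^ 3 - q ^ 2 <= d)%N) /\
  (exists F : {mpoly K[3]},
      irred_plane_curve F (q ^ 3 - q ^ 2)%N /\ AGL2_invariant q F).
Proof.
move=> _ k_gt0 pK _ q; split; first exact: AGL2_invariant_degree_ge k_gt0 pK.
have [T [uT sT memT prodT]] := Fq2_minus_Fq_enum k_gt0 pK.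
exists (dickson_curve p k T).
have Firr := dickson_curve_irreducible k_gt0 pK uT sT memT.
split; last by apply: dickson_curve_invariant => //; apply: (prodT _ (@mpolyC 3 K)).
split; last by split => //; apply: dickson_curve_homog.
by have [F_gt1 _] := Firr; apply: contraTneq F_gt1 => ->; rewrite msize0.
Qed.
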